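(* Let $D$ be an Eulerian tournament with at least one arc. Then there are constants $c_D,C_D>0$ such that $c_D\sqrt{n}\le S_D(n\cdot\mathbf{1})\le C_D\sqrt{n}$ for all $n\ge1$.
   Context: A digraph $D$ has a finite vertex set $V(D)$ and a set $E(D)$ of ordered pairs of distinct vertices (arcs), with at most one arc between any pair. $N^+(v)=\{u:vu\in E(D)\}$, $N^-(v)=\{u:uv\in E(D)\}$, $d^\pm(v)=|N^\pm(v)|$. $D$ is a tournament if for all distinct $u,v$ exactly one of $uv,vu$ is an arc; $D$ is Eulerian if $d^+(v)=d^-(v)$ for all $v$. $\mathbf{1}$ is the all-ones vector indexed by $V(D)$. A restriction vector is a vector $\mathbf{r}$ of nonnegative integers indexed by $V(D)$; $\operatorname{supp}(\mathbf{r})=\{v:\mathbf{r}_v>0\}$; $\delta_v$ is the indicator vector of $v$. Semi-restricted $D$-game with parameter $\mathbf{r}$: Rei and Norman play $\sum_u\mathbf{r}_u$ rounds; in each round both simultaneously choose a vertex, Rei being required to choose each $u$ exactly $\mathbf{r}_u$ times overall, Norman unrestricted. A strategy for Norman is a function $\mathcal{N}$ assigning to each restriction vector a random variable with values in $V(D)$; a strategy for Rei is a function $\mathcal{R}$ assigning to each $\mathbf{r}$ a random variable with values in $\operatorname{supp}(\mathbf{r})$ (choices independent across players and rounds). Norman's score is defined recursively: $0$ if $\mathbf{r}=0$; otherwise with $x=\mathcal{N}(\mathbf{r})$, $y=\mathcal{R}(\mathbf{r})$, Norman gains $+1$ if $y\in N^+(x)$, $-1$ if $y\in N^-(x)$,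 $0$ otherwise, and play continues from $\mathbf{r}-\delta_y$. $S_D(\mathbf{r};\mathcal{N},\mathcal{R})$ is the expected score, $S_D(\mathbf{r};\mathcal{R})=\max_{\mathcal{N}}S_D(\mathbf{r};\mathcal{N},\mathcal{R})$, and $S_D(\mathbf{r})=\min_{\mathcal{R}}S_D(\mathbf{r};\mathcal{R})$. *)

(* Defs.v *)
From HB Require Import structures.
From mathcomp Require Import all_boot all_order all_algebra.
From mathcomp Require Import classical_sets reals.

Set Implicit Arguments.
Unset Strict Implicit.
Unset Printing Implicit Defensive.

Import Order.TTheory GRing.Theory Num.Theory.
Local Open Scope ring_scope.

Record digraph := Digraph {
  vertex :> finType;
  darc : rel vertex;
  darc_irr : irreflexive darc;
  darc_asym : forall u v, darc u v -> ~~ darc v u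
}.
Arguments darc {d}.

Definition outnbhd (D : digraph) (v : D) : {set D} := [set u | darc v u].
Definition innbhd (D : digraph) (v : D) : {set D} := [set u | darc u v].

Definition tournament (D : digraph) : Prop :=
  forall u v : D, u != v -> darc u v (+) darc v u.

Definition eulerian (D : digraph) : Prop :=
  forall v : D, #|outnbhd v| = #|innbhd v|.

Definition restriction (D : digraph) := {ffun D -> nat}.

Definition supp (D : digraph) (r : restriction D) : {set D} :=
  [set v | (0 < r v)%N].

Definition rounds (D : digraph) (r : restriction D) : nat :=
  (\sum_u r u)%N.

Definition decr (D : digraph) (r : restriction D) (y : D) : restriction D :=
  [ffun u => (r u - (u == y))%N].

Section Game.
Variables (R : realType) (D : digraph).
Implicit Types (r : restriction D) (N S : restriction D -> D -> R).

(* A random vertex is represented by its law, here a probability mass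
   function; the choices being independent, the expected score depends on
   nothing else. *)
Definition is_law (p : D -> R) : Prop :=
  (forall v, 0 <= p v) /\ \sum_v p v = 1.

Definition norman_strategy N : Prop := forall r, is_law (N r).

(* At r = 0 the game is over and there is no vertex left in the support, so
   nothing is required of S there. *)
Definition rei_strategy S : Prop :=
  forall r, (0 < rounds r)%N ->
    is_law (S r) /\ (forall v, v \notin supp r -> S r v = 0).

(* Norman's gain when he plays x and Rei plays y. *)
Definition gain (x y : D) : R :=
  if y \in outnbhd x then 1 else if y \in innbhd x then -1 else 0.

Fixpoint score_rounds (k : nat) N S r : R :=
  if k is k'.+1 then
    \sum_x \sum_y N r x * S r y *
      (gain x y + score_rounds k' N S (decr r y))
  else 0.

(* Every round uses up one unit of r, whence the number of recursive steps;
   see score_rec for the recursion on r itself. *)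
Definition score r N S : R := score_rounds (rounds r) N S r.

(* The maximum over Norman's strategies and the minimum over Rei's are written
   as sup and inf. If D has a vertex these are taken over nonempty sets, bounded
   by normr_score_le. *)
Definition best_score r S : R :=
  sup [set score r N S | N in [set N | norman_strategy N]]%classic.

Definition game_value r : R :=
  inf [set best_score r S | S in [set S | rei_strategy S]]%classic.

Lemma rounds_decr r y : y \in supp r -> rounds (decr r y) = (rounds r).-1.
Proof.
rewrite inE => ry; rewrite /rounds (bigD1 y) //= [in RHS](bigD1 y) //= ffunE.
rewrite eqxx (eq_bigr r) => [|u /negbTE uy]; last by rewrite ffunE uy subn0.
by rewrite subn1 -(prednK ry) addSn.
Qed.

Lemma score_rec r N S : rei_strategy S ->
  score r N S = if rounds r == 0%N then 0 else
    \sum_x \sum_y N r x * S r y * (gain x y + score (decr r y) N S).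
Proof.
move=> hS; rewrite /score; case: eqP => [->//|/eqP]; rewrite -lt0n => r0.
have [_ S0] := hS r r0.
rewrite -{1}(prednK r0) /=.
apply: eq_bigr => x _; apply: eq_bigr => y _.
have [ys|/S0->] := boolP (y \in supp r); first by rewrite rounds_decr.
by rewrite mulr0 !mul0r.
Qed.

Lemma normr_gain_le x y : `|gain x y| <= 1.
Proof.
rewrite /gain; case: ifP => _; first by rewrite normr1.
by case: ifP => _; rewrite ?normrN ?normr1 ?normr0.
Qed.

Lemma normr_score_le r N S : norman_strategy N -> rei_strategy S ->
  `|score r N S| <= (rounds r)%:R.
Proof.
move=> hN hS; have [k hk] : exists k, rounds r = k by exists (rounds r).
elim: k r hk => [|k IH] r hk; rewrite score_rec// hk /= ?normr0//.
have r0 : (0 < rounds r)%N by rewrite hk.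
have [[N0 N1] [[S0 S1] Ssupp]] := (hN r, hS r r0).
have -> : k.+1%:R = \sum_x \sum_y N r x * S r y * k.+1%:R :> R.
  under eq_bigr do rewrite -mulr_suml -mulr_sumr S1 mulr1.
  by rewrite -mulr_suml N1 mul1r.
apply: (le_trans (ler_norm_sum _ _ _)); apply: ler_sum => x _.
apply: (le_trans (ler_norm_sum _ _ _)); apply: ler_sum => y _.
rewrite normrM ger0_norm ?mulr_ge0//.
have [ys|/Ssupp->] := boolP (y \in supp r); last by rewrite mulr0 !mul0r.
rewrite ler_wpM2l ?mulr_ge0// -natr1 addrC (le_trans (ler_normD _ _))//.
have dk : rounds (decr r y) = k by rewrite rounds_decr// hk.
by rewrite lerD ?normr_gain_le// (le_trans (IH _ dk))// dk.
Qed.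

End Game.

(* Main.v *)
(** Let m be the number of vertices, T the number of rounds left, d_v the
    deviation of r_v from the mean T / m, and P = sum d_v^2 + (1 - 1/m) T, a
    potential with P(r) - P(r - delta_y) = 2 d_y exactly, so that P is a
    martingale as long as Rei plays uniformly.
    Upper bound: Rei plays uniformly while every vertex is available, which
    costs nothing because D is Eulerian; once a vertex is exhausted the loss is
    at most T, and T <= m sqrt P <= P / sqrt n + (m^2 / 4) sqrt n.
    Lower bound: the gain matrix A is invertible on vectors of sum 0, so some
    perturbation of Norman's uniform law, proportional to a solution e of
    e^T A = d^T, earns him exactly 2 a d_y with a of order 1 / sqrt n.  Hence
    a P is a lower bound for the value while the dispersion sum d_v^2 is O(n).
    When the dispersion reaches T, Norman keeps the current law until the end
    and earns 2 a sum d_v^2 >= a P. *)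
Require Import Defs.
From mathcomp Require Import all_boot all_order all_algebra.
From mathcomp Require Import classical_sets reals.
From mathcomp Require Import ring lra.

Set Implicit Arguments.
Unset Strict Implicit.
Unset Printing Implicit Defensive.

Import Order.TTheory GRing.Theory Num.Theory.
Local Open Scope ring_scope.

Section Digraph.
Variables (R : realType) (D : digraph).
Implicit Types (r : restriction D) (x y v : D).

Let m : R := #|D|%:R.

(** * The gain matrix and its linear systems *)

Lemma gainE x y : gain R x y = (darc x y)%:R - (darc y x)%:R.
Proof.
rewrite /gain !inE; case: (boolP (darc x y)) => [/darc_asym/negbTE->|_].
  by rewrite subr0.
by case: (darc y x); rewrite /= sub0r ?oppr0.
Qed.

Lemma gainC x y : gain R x y = - gain R y x.
Proof. by rewrite !gainE opprB. Qed.

Lemma sum_gain x : eulerian D -> \sum_y gain R x y = 0.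
Proof.
move=> /(_ x) eD; under eq_bigr do rewrite gainE.
rewrite sumrB -!natr_sum; apply/eqP; rewrite subr_eq0 eqr_nat; apply/eqP.
move: eD; rewrite -!sum1_card [in LHS]big_mkcond [in RHS]big_mkcond /= => eD.
transitivity (\sum_i (if i \in outnbhd x then 1 else 0))%N.
  by apply: eq_bigr => i _; rewrite inE; case: darc.
by rewrite eD; apply: eq_bigr => i _; rewrite inE; case: darc.
Qed.

(* Adding 1 to every entry of the gain matrix turns it into a matrix congruent
   to the identity modulo 2, so its determinant is odd. *)
Lemma gain_add1_unitmx : tournament D ->
  \matrix_(i < #|D|, j < #|D|) (gain R (enum_val i) (enum_val j) + 1)
    \in unitmx.
Proof.
move=> tD.
pose M : 'M[int]_#|D| :=
  \matrix_(i, j) ((i == j)%:R + 2 * (darc (enum_val i) (enum_val j))%:R).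
have -> : \matrix_(i < #|D|, j < #|D|) (gain R (enum_val i) (enum_val j) + 1) =
    map_mx intr M.
  apply/matrixP => i j; rewrite !mxE gainE.
  have [->|ij] := eqVneq i j; first by rewrite darc_irr /= subrr add0r.
  have /tD : enum_val i != enum_val j by rewrite (inj_eq enum_val_inj).
  by case: (darc _ _); case: (darc _ _) => //= _; rewrite ?subr0 ?sub0r ?addNr.
rewrite unitmxE det_map_mx unitfE intr_eq0; apply: contraTN isT => /eqP M0.
have : \det (map_mx (intr : int -> 'F_2) M) = 1.
  rewrite -[RHS](det1 _ #|D|); congr (\det _); apply/matrixP => i j.
  rewrite !mxE rmorphD rmorphM /=.
  have -> : 2%:~R = 0 :> 'F_2 by apply/eqP.
  by rewrite mul0r addr0; case: (i == j).
by rewrite det_map_mx M0 => /eqP; rewrite eq_sym oner_eq0.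
Qed.

(** The vector [e] is [w] times the inverse of gain plus all-ones. Rows of the gain matrix sum to 0,
    so summing coordinates gives [#|D|] times the sum of [e] equal to the sum of [w], that is 0. The
    all-ones part then vanishes on [e], leaving the gain matrix alone. *)
Lemma gain_solve : tournament D -> eulerian D ->
  exists2 b : R, 0 < b & forall w : D -> R, \sum_v w v = 0 ->
    exists e : D -> R, [/\ \sum_x e x = 0,
      forall y, \sum_x e x * gain R x y = w y &
      forall s, (forall v, `|w v| <= s) -> forall x, `|e x| <= b * s].
Proof.
move=> tD eD; have := gain_add1_unitmx tD; set M := \matrix_(i, j) _ => uM.
have sumE (F : D -> R) : \sum_x F x = \sum_(i < #|D|) F (enum_val i).
  by rewrite (reindex (@enum_val D predT)) //; apply/onW_bij/enum_val_bij.
(* The double sum dominates every absolute column sum of the inverse; the 1 keeps the constant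
   positive. *)
exists (1 + \sum_i \sum_j `|invmx M i j|).
  by rewrite ltr_pwDl // sumr_ge0 // => i _; rewrite sumr_ge0.
move=> w w0; pose e := \row_i w (enum_val i) *m invmx M.
have eM : e *m M = \row_i w (enum_val i) by rewrite mulmxKV.
have eMj (j : 'I_#|D|) : \sum_i e 0 i * (gain R (enum_val i) (enum_val j) + 1) =
    w (enum_val j).
  have /rowP/(_ j) := eM; rewrite !mxE => <-.
  by apply: eq_bigr => i _; rewrite [M i j]mxE.
have e0 : \sum_i e 0 i = 0.
  have : \sum_(j < #|D|) w (enum_val j) = #|D|%:R * \sum_i e 0 i.
    under eq_bigr do rewrite -eMj; rewrite exchange_big mulr_sumr.
    apply: eq_bigr => i _; rewrite -mulr_sumr big_split /= -sumE sum_gain //.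
    by rewrite add0r sumr_const card_ord mulrC.
  rewrite -sumE w0 => /esym/eqP; rewrite mulf_eq0 => /orP[|/eqP//].
  rewrite pnatr_eq0 => /eqP D0; rewrite big1 // => i _.
  by have := leq_trans (ltn_ord i) (eq_leq D0).
exists (fun x => e 0 (enum_rank x)); split.
- by rewrite sumE -[RHS]e0; apply: eq_bigr => i _; rewrite enum_valK.
- move=> y; rewrite sumE -[y in RHS]enum_rankK -eMj.
  under [RHS]eq_bigr do rewrite mulrDr mulr1.
  rewrite big_split /= e0 addr0.
  by apply: eq_bigr => i _; rewrite enum_valK enum_rankK.
- move=> s ws x; set k := enum_rank x.
  have s0 : 0 <= s by apply: le_trans (ws x).
  rewrite mxE; apply: le_trans (ler_norm_sum _ _ _) _.
  rewrite mulrDl mul1r -[leLHS]add0r lerD // mulr_suml ler_sum // => i _.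
  rewrite normrM mxE mulrC; apply: ler_pM => //.
  by rewrite (bigD1 k) //= lerDl sumr_ge0.
Qed.

(** * Deviations, dispersion and the potential *)

Definition deviation r v : R := (r v)%:R - (rounds r)%:R / m.

Definition dispersion r : R := \sum_v deviation r v ^+ 2.

(* When [y] is uniform, the dispersion of [decr r y] exceeds that of [r] by
   [1 - 1 / m] on average; the linear term makes the potential a martingale. *)
Definition potential r : R := dispersion r + (1 - m^-1) * (rounds r)%:R.

Lemma card_ge1 v : 1 <= m.
Proof. by rewrite ler1n; apply/card_gt0P; exists v. Qed.

Lemma sum_deviation r : \sum_v deviation r v = 0.
Proof.
have [v _|D0] := pickP D; last by rewrite big_pred0.
rewrite sumrB sumr_const -natr_sum -[X in _ - X]mulr_natr -/m divfK ?subrr //.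
by rewrite gt_eqF // (lt_le_trans ltr01 (card_ge1 v)).
Qed.

Lemma dispersion_ge0 r : 0 <= dispersion r.
Proof. by rewrite sumr_ge0 // => v _; rewrite sqr_ge0. Qed.

Lemma deviation_le r v : deviation r v ^+ 2 <= dispersion r.
Proof.
by rewrite /dispersion (bigD1 v) //= lerDl sumr_ge0 // => u _; rewrite sqr_ge0.
Qed.

Lemma rounds_decr_natr r y : y \in supp r ->
  (rounds (decr r y))%:R = (rounds r)%:R - 1 :> R.
Proof.
move=> yr; rewrite rounds_decr // -subn1 natrB //.
by move: yr; rewrite inE /rounds (bigD1 y) //= => /ltn_addr->.
Qed.

Lemma decr_natr r y v : y \in supp r ->
  (decr r y v)%:R = (r v)%:R - (v == y)%:R :> R.
Proof.
by rewrite inE ffunE => yr; rewrite natrB //; case: eqP => // ->.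
Qed.

Lemma dispersion_decr r y : y \in supp r ->
  dispersion (decr r y) = dispersion r - 2 * deviation r y + (1 - m^-1).
Proof.
move=> yr; have m0 : m != 0 by rewrite gt_eqF // (lt_le_trans ltr01 (card_ge1 y)).
(* The deviation at [v] moves by [m^-1 - (v == y)], and the indicator is its own square. *)
have devE v : deviation (decr r y) v ^+ 2 = deviation r v ^+ 2
    - 2 * (deviation r v * (v == y)%:R) + 2 / m * deviation r v
    + (1 - 2 / m) * (v == y)%:R + m^-1 ^+ 2.
  rewrite /deviation decr_natr // rounds_decr_natr //.
  by case: (v == y) => /=; field.
have deltaE (F : D -> R) : \sum_v F v * (v == y)%:R = F y.
  by under eq_bigr do rewrite mulr_natr mulrb; rewrite -big_mkcond big_pred1_eq.
rewrite /dispersion (eq_bigr _ (fun v _ => devE v)) !big_split /= sumrN.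
rewrite -!mulr_sumr deltaE sum_deviation mulr0 addr0.
have -> : \sum_v (v == y)%:R = 1 :> R.
  by rewrite -[RHS](deltaE (fun=> 1)); apply: eq_bigr => v _; rewrite mul1r.
rewrite sumr_const -mulr_natr -/m.
by field.
Qed.

Lemma potential_decr r y : y \in supp r ->
  potential (decr r y) = potential r - 2 * deviation r y.
Proof.
by move=> yr; rewrite /potential dispersion_decr // rounds_decr_natr //; ring.
Qed.

Lemma rounds_const n : rounds ([ffun=> n] : restriction D) = (n * #|D|)%N.
Proof.
rewrite /rounds; under eq_bigr do rewrite ffunE.
by rewrite sum_nat_const mulnC.
Qed.

Lemma dispersion_const n : dispersion [ffun=> n] = 0.
Proof.
apply: big1 => v _; rewrite /deviation ffunE rounds_const natrM mulfK.
  by rewrite subrr expr0n.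
by rewrite gt_eqF // (lt_le_trans ltr01 (card_ge1 v)).
Qed.

(** * Rei's uniform strategy and one round of play *)

Definition uniform_rei r v : R := (v \in supp r)%:R / #|supp r|%:R.

Lemma uniform_rei_strategy : rei_strategy uniform_rei.
Proof.
move=> r r0; split=> [|v /negbTE vr]; last by rewrite /uniform_rei vr mul0r.
split=> [v|]; first by rewrite divr_ge0.
rewrite -mulr_suml -natr_sum; have -> : (\sum_v (v \in supp r) = #|supp r|)%N.
  by rewrite -sum1_card [RHS]big_mkcond; apply: eq_bigr => v _; case: (v \in _).
rewrite mulfV // pnatr_eq0 -lt0n card_gt0; apply: contraTneq r0 => s0.
rewrite -eqn0Ngt /rounds big1 // => v _; apply/eqP; rewrite eqn0Ngt.
by have /setP/(_ v) := s0; rewrite !inE => ->.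
Qed.

Section Score.
Variables (N S : restriction D -> D -> R).
Hypotheses (hN : norman_strategy N) (hS : rei_strategy S).

Lemma score_step r : (0 < rounds r)%N ->
  score r N S =
    \sum_y S r y * (\sum_x N r x * gain R x y + score (decr r y) N S).
Proof.
move=> r0; rewrite score_rec // gtn_eqF // exchange_big; apply: eq_bigr => y _.
under eq_bigr do rewrite mulrDr; rewrite big_split /= mulrDr; congr (_ + _).
  by rewrite mulr_sumr; apply: eq_bigr => x _; rewrite mulrCA mulrA.
by rewrite -mulr_suml -mulr_suml (hN r).2 mul1r.
Qed.

Lemma ler_sum_rei r (F G : D -> R) : (0 < rounds r)%N ->
  (forall y, y \in supp r -> F y <= G y) ->
  \sum_y S r y * F y <= \sum_y S r y * G y.
Proof.
move=> r0 FG; have [[S0 _] Ssupp] := hS r0; apply: ler_sum => y _.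
have [/FG FGy|/Ssupp->] := boolP (y \in supp r); last by rewrite !mul0r.
exact: ler_wpM2l.
Qed.

Lemma sum_rei_const r c : (0 < rounds r)%N -> \sum_y S r y * c = c.
Proof. by move=> r0; rewrite -mulr_suml (hS r0).1.2 mul1r. Qed.

End Score.

Lemma rounds0_nat r y : rounds r = 0%N -> r y = 0%N.
Proof. by move/eqP; rewrite sum_nat_eq0 => /forallP/(_ y)/eqP. Qed.

(** * Upper bound *)

(** With [T] rounds left, an exhausted vertex has deviation [- T / m], so [T^2 / m^2] is at most the
    potential. Expanding [(T - m^2 s / 2)^2 >= 0] trades this square for a linear bound on [T]. *)
Lemma rounds_le_potential r v s : r v = 0%N -> 0 < s ->
  (rounds r)%:R <= potential r / s + m ^+ 2 / 4 * s.
Proof.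
move=> rv s0; have m1 := card_ge1 v.
have m0 : 0 < m by rewrite (lt_le_trans ltr01).
have := deviation_le r v; rewrite /deviation rv sub0r sqrrN expr_div_n.
rewrite ler_pdivrMr ?exprn_gt0 // => rd.
have pd : dispersion r <= potential r.
  by rewrite lerDl mulr_ge0 // subr_ge0 invf_le1.
rewrite -(ler_pM2r s0) mulrDl divfK ?gt_eqF //.
rewrite -(ler_pM2r (exprn_gt0 2 m0)) (le_trans _ (_ : dispersion r * m ^+ 2 +
  m ^+ 2 / 4 * s * s * m ^+ 2 <= _)) //; last first.
  by rewrite [leRHS]mulrDl lerD2r ler_wpM2r // sqr_ge0.
have := sqr_ge0 ((rounds r)%:R - m ^+ 2 * s / 2); lra.
Qed.

Lemma score_uniform_le N s r (v0 : D) : eulerian D -> norman_strategy N ->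
  0 < s ->
  score r N uniform_rei <= potential r / s + m ^+ 2 / 4 * s.
Proof.
move=> eD hN s0; have hS := uniform_rei_strategy.
have m0 : m != 0 by rewrite gt_eqF // (lt_le_trans ltr01 (card_ge1 v0)).
have [k hk] : exists k, rounds r = k by exists (rounds r).
elim: k r hk => [|k IH] r hk; have [v /eqP rv|rn0] := pickP (fun v => r v == 0%N).
- exact: le_trans (le_trans (ler_norm _) (normr_score_le r hN hS))
    (rounds_le_potential rv s0).
(* With no round left every vertex is exhausted, and [v0] is one. *)
- by have := rn0 v0; rewrite rounds0_nat.
- exact: le_trans (le_trans (ler_norm _) (normr_score_le r hN hS))
    (rounds_le_potential rv s0).
have r0 : (0 < rounds r)%N by rewrite hk.
have rT : supp r = [set: D] by apply/setP => v; rewrite !inE lt0n rn0.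
have SE y : uniform_rei r y = m^-1 by rewrite /uniform_rei rT inE cardsT mul1r.
rewrite score_step //.
apply: le_trans (_ : \sum_y uniform_rei r y * (\sum_x N r x * gain R x y +
    (potential r / s + m ^+ 2 / 4 * s - 2 / s * deviation r y)) <= _).
  apply: ler_sum_rei => // y yr; rewrite lerD2l.
  apply: le_trans (IH _ _) _; first by rewrite rounds_decr // hk.
  by rewrite potential_decr // le_eqVlt; apply/orP; left; apply/eqP; ring.
under eq_bigr do rewrite SE.
have dev0 : \sum_y 2 / s * deviation r y = 0.
  by rewrite -mulr_sumr sum_deviation mulr0.
rewrite -mulr_sumr !big_split /= sumrN dev0 subr0.
rewrite exchange_big big1 => [|x _]; last by rewrite -mulr_sumr sum_gain ?mulr0.
by rewrite add0r -big_split sumr_const -[X in _ * X]mulr_natl mulKf.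
Qed.

(** * Lower bound *)

(* What Rei will do next does not depend on Norman's vertex, so maximizing the
   expected gain of the current round is optimal. *)
Lemma greedy_norman S (v0 : D) : rei_strategy S ->
  exists2 N : restriction D -> D -> R, norman_strategy N &
    forall r q, (0 < rounds r)%N -> is_law q ->
      \sum_y S r y * (\sum_x q x * gain R x y + score (decr r y) N S)
        <= score r N S.
Proof.
move=> hS; pose F r x := \sum_y S r y * gain R x y.
pose g r := [arg max_(x > v0) F r x]%O.
have gP r x : F r x <= F r (g r) by rewrite /g; case: arg_maxP => // i _; exact.
pose N r x : R := (x == g r)%:R.
have NE r (G : D -> R) : \sum_x N r x * G x = G (g r).
  by under eq_bigr do rewrite mulr_natl mulrb; rewrite -big_mkcond big_pred1_eq.
have hN : norman_strategy N.
  move=> r; split=> [x|]; first exact: ler0n.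
  by rewrite -[RHS](NE r (fun=> 1)); apply: eq_bigr => x _; rewrite mulr1.
exists N => // r q r0 [q0 q1]; rewrite score_step //.
under eq_bigr do rewrite mulrDr; under [leRHS]eq_bigr do rewrite mulrDr NE.
rewrite !big_split /= lerD2r -/(F r (g r)).
have -> : \sum_y S r y * (\sum_x q x * gain R x y) = \sum_x q x * F r x.
  under eq_bigr do rewrite mulr_sumr; rewrite exchange_big.
  by apply: eq_bigr => x _; rewrite mulr_sumr; apply: eq_bigr => y _; rewrite mulrCA.
by rewrite -[leRHS]mul1r -q1 mulr_suml ler_sum // => x _; rewrite ler_wpM2l.
Qed.

Section Lower.
Variables (N S : restriction D -> D -> R).
Hypotheses (hN : norman_strategy N) (hS : rei_strategy S).
Hypothesis score_ge_step : forall r q, (0 < rounds r)%N -> is_law q ->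
  \sum_y S r y * (\sum_x q x * gain R x y + score (decr r y) N S)
    <= score r N S.

(** Rei must play each [y] exactly [r y] times, so the total earned by a constant law [q] does not
    depend on Rei's order of play; by [score_ge_step], [N] does at least as well. *)
Lemma score_ge_static q r : is_law q ->
  \sum_y (r y)%:R * (\sum_x q x * gain R x y) <= score r N S.
Proof.
move=> hq; have [k hk] : exists k, rounds r = k by exists (rounds r).
elim: k r hk => [|k IH] r hk.
  rewrite score_rec // hk /= big1 // => y _.
  by rewrite (rounds0_nat y hk) mul0r.
have r0 : (0 < rounds r)%N by rewrite hk.
apply: le_trans (score_ge_step r0 hq); rewrite -[leLHS](sum_rei_const hS _ r0).
apply: ler_sum_rei => // y yr; rewrite -lerBlDl.
apply: le_trans (IH _ _); last by rewrite rounds_decr // hk.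
rewrite lerBlDl (bigD1 y) //= [X in _ <= _ + X](bigD1 y) //= decr_natr // eqxx.
rewrite mulrBl mul1r addrA subrKC lerD2l ler_sum // => v /negbTE vy.
by rewrite decr_natr // vy subr0.
Qed.

Lemma score_ge_potential a t r (v0 : D) : 0 <= a -> 1 <= t ->
  (forall r, (forall v, `|deviation r v| <= 2 * t) -> exists2 q, is_law q &
    forall y, \sum_x q x * gain R x y = 2 * a * deviation r y) ->
  (rounds r)%:R <= t ^+ 2 -> dispersion r <= (2 * t) ^+ 2 ->
  a * potential r <= score r N S.
Proof.
move=> a0 t1 hlaw; have m1 := card_ge1 v0.
have im : 0 <= m^-1 <= 1.
  by rewrite invr_ge0 (le_trans ler01 m1) invf_le1 // (lt_le_trans ltr01).
have t21 : 1 <= t ^+ 2 by rewrite exprn_ege1.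
have [k hk] : exists k, rounds r = k by exists (rounds r).
elim: k r hk => [|k IH] r hk rt rd.
  have r0 y : r y = 0%N by apply: rounds0_nat.
  rewrite score_rec // hk /= /potential hk mulr0 addr0 /dispersion big1 ?mulr0 //.
  by move=> y _; rewrite /deviation r0 hk mul0r subrr expr0n.
have [|q hq qE] := hlaw r.
  move=> v; rewrite -ler_sqr ?nnegrE ?mulr_ge0 ?(le_trans ler01 t1) //.
  by rewrite real_normK ?num_real // (le_trans (deviation_le _ _)).
have r0 : (0 < rounds r)%N by rewrite hk.
(* If the dispersion is at least the number of rounds, the potential is at most twice the
   dispersion, and the constant law [q] earns [2 * a] times the dispersion. *)
have [rdt|dtr] := leP (rounds r)%:R (dispersion r).
  apply: le_trans (score_ge_static r hq).
  under eq_bigr do rewrite qE mulrCA; rewrite -mulr_sumr.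
  have -> : \sum_y (r y)%:R * deviation r y = dispersion r.
    rewrite /dispersion [RHS](eq_bigr (fun y =>
      (r y)%:R * deviation r y - (rounds r)%:R / m * deviation r y)).
      by rewrite sumrB -mulr_sumr sum_deviation mulr0 subr0.
    by move=> y _; rewrite expr2 {1}/deviation mulrBl.
  rewrite [2 * a]mulrC -mulrA ler_wpM2l // /potential.
  by have := ler0n R (rounds r); nra.
apply: le_trans (score_ge_step r0 hq).
rewrite -[leLHS](sum_rei_const hS _ r0); apply: ler_sum_rei => // y yr.
have : a * potential (decr r y) <= score (decr r y) N S.
  apply: IH; first by rewrite rounds_decr // hk.
    by rewrite rounds_decr_natr //; lra.
  (* Here the dispersion is below [t ^+ 2]. Since [- 2 d <= d^2 + 1], one round at most doubles it
     and adds 2, giving at most [2 t^2 + 2 <= (2 t)^2]. *)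
  rewrite dispersion_decr //; have := deviation_le r y.
  have := sqr_ge0 (deviation r y + 1); nra.
by rewrite potential_decr // qE; lra.
Qed.

End Lower.

(** The law is [m^-1 + 2 * a * e] with [e] from [gain_solve]. The uniform part earns 0, and
    [|e x| <= 2 * b * t] with the smallness of [a] keeps the law nonnegative. *)
Lemma perturbed_uniform_law : tournament D -> eulerian D -> D ->
  exists2 b : R, 0 < b & forall a t r, 0 <= a -> 4 * a * b * t * m <= 1 ->
    (forall v, `|deviation r v| <= 2 * t) -> exists2 q, is_law q &
    forall y, \sum_x q x * gain R x y = 2 * a * deviation r y.
Proof.
move=> tD eD v0; have m1 := card_ge1 v0.
have m0 : 0 < m by rewrite (lt_le_trans ltr01).
have [b b0 hb] := gain_solve tD eD; exists b => // a t r a0 at1 dt.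
have [e [e0 eE /(_ _ dt) et]] := hb _ (sum_deviation r).
exists (fun x => m^-1 + 2 * a * e x); first split.
- move=> x; have := et x; rewrite ler_norml => /andP[ex _].
  have : 2 * a * (b * (2 * t)) <= m^-1.
    rewrite -(ler_pM2r m0) mulVf ?gt_eqF //.
    by rewrite (_ : _ * m = 4 * a * b * t * m) //; ring.
  by nra.
- rewrite big_split /= -mulr_sumr e0 mulr0 addr0 sumr_const -mulr_natl.
  by rewrite mulfV ?gt_eqF.
move=> y; under eq_bigr do rewrite mulrDl -[_ * e _ * _]mulrA.
rewrite big_split /= -!mulr_sumr eE.
have -> : \sum_x gain R x y = 0.
  under eq_bigr do rewrite gainC.
  by rewrite sumrN sum_gain // oppr0.
by rewrite mulr0 add0r.
Qed.

End Digraph.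

(** * Choice of parameters and passage to the game value *)

Theorem theorem1p4 (R : realType) (D : digraph) :
  tournament D -> eulerian D -> (exists u v : D, darc u v) ->
  exists c C : R, [/\ 0 < c, 0 < C &
    forall n : nat, (1 <= n)%N ->
      c * Num.sqrt n%:R <= game_value R ([ffun=> n] : restriction D)
        <= C * Num.sqrt n%:R].
Proof.
move=> tD eD [u [v uv]]; have [b b0 hb] := perturbed_uniform_law R tD eD u.
set m : R := #|D|%:R in hb.
have m1 : 1 < m.
  rewrite ltr1n (cardD1 u) (cardD1 v) !inE.
  by case: eqVneq uv => // ->; rewrite darc_irr.
have m0 : 0 < m by lra.
have bm0 : 0 < 4 * b * m ^+ 2 by rewrite !mulr_gt0 ?exprn_gt0.
(* The initial potential is [(m - 1) * n]: the first constant is this times [a / sqrt n] for the [a]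
   below, the second comes from [score_uniform_le] with [m - 1] relaxed to [m]. *)
exists ((m - 1) / (4 * b * m ^+ 2)), (m + m ^+ 2 / 4); split.
- by rewrite divr_gt0 // subr_gt0.
- by rewrite addr_gt0 ?divr_gt0 ?exprn_gt0.
move=> n n1; set r : restriction D := [ffun=> n].
set s : R := Num.sqrt n%:R.
have s1 : 1 <= s by rewrite -sqrtr1 ler_sqrt ?ler0n // ler1n.
have s0 : 0 < s by lra.
have ss : s ^+ 2 = n%:R by rewrite sqr_sqrtr ?ler0n.
have rE : (rounds r)%:R = m * s ^+ 2 by rewrite rounds_const natrM ss mulrC.
have potE : potential R r = (m - 1) * s ^+ 2.
  rewrite /potential dispersion_const add0r rE -/m.
  by field; rewrite gt_eqF.
(* A witness that the set under the supremum is nonempty. *)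
pose N0 (_ : restriction D) (x : D) : R := (x == u)%:R.
have hN0 : norman_strategy N0.
  move=> r'; split=> [x|]; first exact: ler0n.
  rewrite (bigD1 u) //= /N0 eqxx big1 ?addr0 // => x /negbTE.
  by rewrite /N0 => ->.
have scores_ub (S : restriction D -> D -> R) : rei_strategy S ->
    has_ubound [set score r N S | N in [set N | norman_strategy N]]%classic.
  move=> hS; exists (rounds r)%:R => _ [N hN <-].
  exact: le_trans (ler_norm _) (normr_score_le r hN hS).
have lower (S : restriction D -> D -> R) : rei_strategy S ->
    (m - 1) / (4 * b * m ^+ 2) * s <= best_score r S.
  move=> hS; have [N hN Nstep] := greedy_norman u hS.
  apply: (@le_trans _ _ (score r N S)); last first.
    by apply: (ub_le_sup (scores_ub S hS)); exists N.
  have ms1 : 1 <= m * s by rewrite mulr_ege1 // ltW.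
  (* The largest [a] with [4 * a * b * t * m <= 1] for [t = m * s], a choice of [t] whose square
     bounds the number [m * s ^+ 2] of rounds. *)
  pose a := (4 * b * m ^+ 2 * s)^-1.
  have a0 : 0 <= a by rewrite invr_ge0 mulr_ge0 // ltW.
  have b_neq0 : b != 0 by rewrite gt_eqF.
  have m_neq0 : m != 0 by rewrite gt_eqF.
  have s_neq0 : s != 0 by rewrite gt_eqF.
  have -> : (m - 1) / (4 * b * m ^+ 2) * s = a * potential R r.
    by rewrite potE /a; field; rewrite b_neq0 m_neq0 s_neq0.
  apply: (score_ge_potential hS Nstep u a0 ms1) => [r'||].
  - apply: hb => //; rewrite le_eqVlt; apply/orP; left; apply/eqP.
    by rewrite /a; field; rewrite b_neq0 m_neq0 s_neq0.
  - by rewrite rE exprMn ler_wpM2r ?sqr_ge0 // expr2 ler_pMr // ltW.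
  - by rewrite dispersion_const sqr_ge0.
have hU := @uniform_rei_strategy R D.
apply/andP; split.
  apply: lb_le_inf => [|_ [S hS <-]]; last exact: lower.
  by exists (best_score r (uniform_rei R (D := D))), (uniform_rei R (D := D)).
apply: (@le_trans _ _ (best_score r (uniform_rei R (D := D)))).
  apply: ge_inf; last by exists (uniform_rei R (D := D)).
  exists ((m - 1) / (4 * b * m ^+ 2) * s) => _ [S hS <-]; exact: lower.
apply: ge_sup => [|_ [N hN <-]].
  by exists (score r N0 (uniform_rei R (D := D))), N0.
apply: le_trans (score_uniform_le r u eD hN s0) _; rewrite -/m potE.
have -> : (m - 1) * s ^+ 2 / s = (m - 1) * s by field; rewrite gt_eqF.
by nra.
Qed.
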